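(* Let $\mathcal A,\mathcal B\in\mathbb{C}^{I_1\times\cdots\times I_N\times I_1\times\cdots\times I_N}$ be random positive definite tensors. For every $0<\omega\le1$, all positive integers $m,n$ and every $\theta>0$, $$\Pr\left(\left\|\mathcal A^{n\omega}-\mathcal B^{m\omega}\right\|\ge\theta\right)\le\frac{(\mathbb{I}_1^N)^2}{\omega\theta}\left[\min_{c>0}\left(\sqrt{2c}\,\|g(t)\|_2+\sqrt{2/c}\,\|g'(t)\|_2\right)\right]\mathbb{E}\left(\left\|\mathcal A^n-\mathcal B^m\right\|^\omega\right),$$ where $$g(t)=\frac{\exp\left(\frac{\omega t}2\right)-\exp\left(\frac{-\omega t}2\right)}{\exp\left(\frac t2\right)-\exp\left(\frac{-t}2\right)} .$$
   Context: $\mathbb{I}_1^N=I_1\cdots I_N$. Products and powers of square tensors are with respect to the Einstein product $(\mathcal X\star_N\mathcal Y)_{i_1\ldots i_N,k_1\ldots k_N}=\sum_{j_1,\ldots,j_N}x_{i_1\ldots i_N,j_1\ldots j_N}y_{j_1\ldots j_N,k_1\ldots k_N}$. Every Hermitian tensor has an eigen-decomposition $\mathcal H=\sum_{i=1}^{\mathbb{I}_1^N}\lambda_i\mathcal P_i$ with real $\lambda_i$ and $\mathcal P_i=\mathcal U_i\star_1\mathcal U_i^H$, the $\mathcal U_i\in\mathbb{C}^{I_1\times\cdots\times I_N\times1}$ orthonormal; it is positive definite if all $\lambda_i>0$, and then $\mathcal H^p=\sum_i\lambda_i^p\mathcal P_i$ for real $p$. $\|\cdot\|$ on tensors is the spectral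 norm (largest singular value); $\|\cdot\|_2$ on functions is the $L^2(\mathbb{R})$ norm; $g'$ is the derivative of $g$, and $g(0)$ is defined by continuity. *)

(* Defs.v *)
From HB Require Import structures.
From mathcomp Require Import all_boot all_order all_algebra.
From mathcomp Require Import all_classical all_reals all_analysis.
From mathcomp.real_closed Require Import complex.

Set Implicit Arguments.
Unset Strict Implicit.
Unset Printing Implicit Defensive.

Import Order.TTheory GRing.Theory Num.Theory.
Import numFieldNormedType.Exports.

Local Open Scope classical_set_scope.
Local Open Scope ring_scope.

Section Tensors.
Context {R : realType} {N : nat} (I : 'I_N -> nat).

(* A multi-index (i_1, ..., i_N), each i_k ranging over I_k values. *)
Definition multi_index := {dffun forall k : 'I_N, 'I_(I k)}.

Definition tensor_dim : nat := (\prod_(k < N) I k)%N.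

Definition tensor := {ffun multi_index * multi_index -> R[i]}.

(* The trailing mode, of size 1, of I_1 x ... x I_N x 1 is left out. *)
Definition tensor_col := {ffun multi_index -> R[i]}.

Definition einstein_mul (X Y : tensor) : tensor :=
  [ffun p => \sum_(j : multi_index) X (p.1, j) * Y (j, p.2)].

Definition tensor_id : tensor := [ffun p => (p.1 == p.2)%:R].

Definition tensor_exp (X : tensor) (n : nat) : tensor :=
  iter n (einstein_mul X) tensor_id.

Definition tensor_adj (X : tensor) : tensor :=
  [ffun p => ((X (p.2, p.1))^*)%C].

Definition hermitian_tensor (X : tensor) : Prop := tensor_adj X = X.

(* The contraction of U with U^H runs over the single value of the mode of
   size 1, hence has one term. *)
Definition eigen_proj (U : tensor_col) : tensor :=
  [ffun p => U p.1 * ((U p.2)^*)%C].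

Definition orthonormal_cols (U : 'I_tensor_dim -> tensor_col) : Prop :=
  forall i j, \sum_(a : multi_index) ((U i a)^*)%C * U j a = (i == j)%:R.

Definition eigen_data : Type :=
  (('I_tensor_dim -> R) * ('I_tensor_dim -> tensor_col))%type.

Definition spectral_sum (f : R -> R) (e : eigen_data) : tensor :=
  \sum_(i < tensor_dim) (f (e.1 i))%:C%C *: eigen_proj (e.2 i).

Definition eigen_decomposition (H : tensor) (e : eigen_data) : Prop :=
  orthonormal_cols e.2 /\ H = spectral_sum id e.

(* A fixed choice of eigen-decomposition of H; the default value is only used
   when H is not Hermitian. *)
Definition eigen_of (H : tensor) : eigen_data :=
  xget ((fun=> 0), (fun=> 0)) [set e | eigen_decomposition H e].

Definition eigenvalue_of (H : tensor) (i : 'I_tensor_dim) : R :=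
  (eigen_of H).1 i.

Definition positive_definite (H : tensor) : Prop :=
  hermitian_tensor H /\
  exists2 e, eigen_decomposition H e & forall i, 0 < e.1 i.

(* H^p for real p and positive definite H; the result does not depend on the
   chosen eigen-decomposition. *)
Definition tensor_powR (H : tensor) (p : R) : tensor :=
  spectral_sum (fun x => x `^ p) (eigen_of H).

Definition singular_value (X : tensor) (i : 'I_tensor_dim) : R :=
  Num.sqrt (eigenvalue_of (einstein_mul (tensor_adj X) X) i).

(* Singular values are nonnegative, so the neutral element 0 does not alter
   the maximum. *)
Definition spectral_norm (X : tensor) : R :=
  \big[Num.max/0]_(i < tensor_dim) singular_value X i.

(* Measurability for the Borel sigma-algebra of a finite-dimensional complex
   space, tested on the real and imaginary parts of the entries. *)
Definition random_tensor d (T : measurableType d) (X : T -> tensor) : Prop :=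
  forall p : multi_index * multi_index,
    measurable_fun [set: T] (fun t => complex.Re (X t p)) /\
    measurable_fun [set: T] (fun t => complex.Im (X t p)).

End Tensors.

Arguments tensor R {N} I.

Section ScalarBound.
Context {R : realType}.

Definition sinh_ratio (w t : R) : R :=
  (expR (w * t / 2) - expR (- (w * t) / 2)) / (expR (t / 2) - expR (- t / 2)).

(* The quotient is 0 / 0 at the origin; its value there is the limit. *)
Definition gfun (w t : R) : R :=
  if t == 0 then lim (sinh_ratio w s @[s --> (0 : R)^']) else sinh_ratio w t.

Definition L2norm (f : R -> R) : \bar R :=
  ('N[@lebesgue_measure R]_(2%:E)[EFin \o f])%E.

(* Extended-real valued: for w = 1, g is the constant 1, whose L^2 norm is +oo,
   so that every value of the bound is +oo. *)
Definition g_bound (w c : R) : \bar R :=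
  ((Num.sqrt (2 * c))%:E * L2norm (gfun w) +
   (Num.sqrt (2 / c))%:E * L2norm (derive1 (gfun w)))%E.

End ScalarBound.

Definition is_minimum {R : realType} (S : set (\bar R)) (M : \bar R) : Prop :=
  S M /\ lbound S M.

(* Main.v *)
Require Import Defs.
From HB Require Import structures.
From mathcomp Require Import all_boot all_order all_algebra.
From mathcomp Require Import ring lra.
From mathcomp Require Import all_classical all_reals all_analysis.
From mathcomp Require Import measurable_realfun.
From mathcomp.real_closed Require Import complex.

Set Implicit Arguments.
Unset Strict Implicit.
Unset Printing Implicit Defensive.

Import Order.TTheory GRing.Theory Num.Theory.
Import numFieldNormedType.Exports.

Local Open Scope classical_set_scope.
Local Open Scope ring_scope.

(** Write D for the number of multi-indices.  The tail bound is Markov's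
inequality applied to a deterministic inequality between the two random norms,
combined with a lower bound for the bracket of the statement.

Deterministic part ([spectral_norm_powR_le]).  Let x_i, u_i and y_j, v_j be
the eigenvalues and orthonormal eigenvectors of A and B.  In the mixed basis
the difference of two functions of A and B is explicit:
<<
  <u_i, (f(A) - g(B)) v_j> = (f(x_i) - g(y_j)) <u_i, v_j>.
>>
Since |a^w - b^w| <= |a - b|^w for a, b >= 0 and 0 <= w <= 1, and since
|<u_i, v_j>| <= |<u_i, v_j>|^w because |<u_i, v_j>| <= 1, each mixed entry of
A^{nw} - B^{mw} is at most
<<
  |(x_i^n - y_j^m) <u_i, v_j>|^w <= || A^n - B^m ||^w.
>>
A tensor all of whose D^2 mixed entries are at most k has spectral norm at
most its Frobenius norm, hence at most D k.  Therefore
|| A^{nw} - B^{mw} || <= D || A^n - B^m ||^w, and Markov's inequality gives a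
tail bound with the constant D / theta.

Scalar part ([g_bound_min]).  It remains to see that D / theta does not exceed
D^2 / (w theta) times the bracket, for which it is enough that every
expression under the minimum is at least w = g(0).  This is a one-dimensional
Sobolev inequality: integrating the derivative of (t + a - s) g(s) in s over
the interval from t to t + a, then applying the Cauchy-Schwarz inequality,
gives
<<
  a g(t) <= sqrt a ||g||_2 + a sqrt a ||g'||_2,
>>
and one takes a = 1 / (2 c) and lets t decrease to 0.  The same lower bound,
valid for all c at once, excludes that one of the two norms vanishes while
both are finite, which is why the infimum over c is attained; if one of the
norms is infinite (as for w = 1) the expression is constantly infinite.

Measurability.  The event and the integrand have to be measurable, although
the eigen-decompositions behind them are chosen arbitrarily.  The spectral
norm of Z is the limit of (tr (Z^H Z)^k)^{1/(2k)}
([measurable_spectral_norm]).  For A^p, the functions f for which f(A) is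
measurable form an algebra closed under pointwise limits on the positive
half-line; it contains the polynomials, is stable under composition with the
exponential series, contains ln as the limit of Newton's iteration for
exp y = x, and so contains x^p = exp (p ln x) ([random_tensor_powR]). *)

(** * Unitary conjugation and Gram matrices *)

Section UnitaryDiagonalization.
Context {C : numClosedFieldType} {n : nat}.
Local Open Scope sesquilinear_scope.
Implicit Types (M U V W : 'M[C]_n) (l mu : 'rV[C]_n).

Lemma unitary_adjmul U : U \is unitarymx -> U^t* *m U = 1%:M.
Proof. by move/unitarymxP/mulmx1C. Qed.

Lemma unitary_row_norm U i : U \is unitarymx -> \sum_k `|U i k| ^+ 2 = 1.
Proof.
move=> /unitarymxP /matrixP /(_ i i); rewrite !mxE eqxx => U1.
by rewrite -[RHS]U1; apply: eq_bigr => k _; rewrite !mxE normCK.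
Qed.

Lemma unitary_entry_le1 U i j : U \is unitarymx -> `|U i j| <= 1.
Proof.
move=> uU; rewrite -(@expr_le1 _ 2) // -(unitary_row_norm i uU) (bigD1 j) //=.
by rewrite lerDl sumr_ge0 // => k _; rewrite exprn_ge0.
Qed.

Lemma mul_unitary_adj U V : U \is unitarymx -> V \is unitarymx ->
  U *m V^t* \is unitarymx.
Proof. by move=> uU uV; rewrite mul_unitarymx // trmxC_unitary. Qed.

Lemma adjM M1 M2 : (M1 *m M2)^t* = M2^t* *m M1^t*.
Proof. by rewrite trmx_mul map_mxM. Qed.

Lemma adj_diagM W l mu : W \is unitarymx ->
  (W^t* *m diag_mx l *m W) *m (W^t* *m diag_mx mu *m W)
  = W^t* *m (diag_mx l *m diag_mx mu) *m W.
Proof.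
move=> /unitarymxP W1; rewrite !mulmxA.
by congr (_ *m _ *m _); rewrite -[LHS]mulmxA W1 mulmx1.
Qed.

Lemma conj_adj_diag W l : W \is unitarymx ->
  W *m (W^t* *m diag_mx l *m W) *m W^t* = diag_mx l.
Proof.
by move=> /unitarymxP W1; rewrite !mulmxA W1 mul1mx -[LHS]mulmxA W1 mulmx1.
Qed.

Lemma conj_adj_diag_unitary V W l :
  V *m (W^t* *m diag_mx l *m W) *m V^t*
  = (V *m W^t*) *m diag_mx l *m (V *m W^t*)^t*.
Proof. by rewrite adjM trmxCK !mulmxA. Qed.

Lemma diag_conj_entry V l i :
  (V *m diag_mx l *m V^t*) i i = \sum_k l 0 k * `|V i k| ^+ 2.
Proof.
rewrite mxE; apply: eq_bigr => k _.
by rewrite mul_mx_diag !mxE mulrAC -normCK mulrC.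
Qed.

Lemma adjmul_diag M j : (M^t* *m M) j j = \sum_i `|M i j| ^+ 2.
Proof. by rewrite mxE; apply: eq_bigr => i _; rewrite !mxE normCKC. Qed.

Lemma mxtrace_gram M : \tr (M^t* *m M) = \sum_j \sum_i `|M i j| ^+ 2.
Proof. by apply: eq_bigr => j _; rewrite adjmul_diag. Qed.

Lemma conj_gram M U V : U \is unitarymx ->
  (U *m M *m V^t*)^t* *m (U *m M *m V^t*) = V *m (M^t* *m M) *m V^t*.
Proof.
move=> uU; rewrite !adjM trmxCK -!mulmxA; congr (_ *m (_ *m _)).
by rewrite [LHS]mulmxA unitary_adjmul // mul1mx.
Qed.

(** Conjugation by [W] turns [mu 0 i] into a squared column norm. *)
Lemma gram_diag_ge0 M W mu i : W \is unitarymx ->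
  M^t* *m M = W^t* *m diag_mx mu *m W -> 0 <= mu 0 i.
Proof.
move=> uW E; have := adjmul_diag (W *m M *m W^t*) i.
rewrite conj_gram // E conj_adj_diag // mxE eqxx mulr1n => ->.
by rewrite sumr_ge0 // => k _; rewrite exprn_ge0.
Qed.

(** An entry is bounded by the norm of its column, and a squared column norm of
[U *m M *m V^t*] is an average of the diagonal values [mu] weighted by the
squared entries of a row of a unitary matrix. *)
Lemma entry_le_gram_diag M U V W mu (s : C) i j :
  U \is unitarymx -> V \is unitarymx -> W \is unitarymx ->
  M^t* *m M = W^t* *m diag_mx mu *m W -> (forall k, mu 0 k <= s) ->
  `|(U *m M *m V^t*) i j| ^+ 2 <= s.
Proof.
move=> uU uV uW E mus.
apply: (@le_trans _ _ (((U *m M *m V^t*)^t* *m (U *m M *m V^t*)) j j)).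
  rewrite adjmul_diag (bigD1 i) //= lerDl.
  by rewrite sumr_ge0 // => k _; rewrite exprn_ge0.
rewrite conj_gram // E conj_adj_diag_unitary diag_conj_entry.
rewrite -[leRHS]mulr1 -(unitary_row_norm j (mul_unitary_adj uV uW)) mulr_sumr.
by apply: ler_sum => k _; rewrite ler_wpM2r ?exprn_ge0.
Qed.

(** The trace of the Gram matrix, which dominates each of its eigenvalues, is
the squared Frobenius norm and is unchanged by [U] and [V]. *)
Lemma gram_diag_le_entries M U V W mu i :
  U \is unitarymx -> V \is unitarymx -> W \is unitarymx ->
  M^t* *m M = W^t* *m diag_mx mu *m W ->
  mu 0 i <= \sum_j \sum_k `|(U *m M *m V^t*) k j| ^+ 2.
Proof.
move=> uU uV uW E.
have tr_conj V' (G : 'M[C]_n) : V' \is unitarymx ->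
    \tr (V' *m G *m V'^t*) = \tr G.
  by move=> uV'; rewrite mxtrace_mulC mulmxA unitary_adjmul // mul1mx.
rewrite -mxtrace_gram conj_gram // tr_conj // -(tr_conj W) // E.
rewrite conj_adj_diag // mxtrace_diag (bigD1 i) //= lerDl.
by rewrite sumr_ge0 // => k _; exact: gram_diag_ge0 E.
Qed.

(** Each [l 0 i] is an average of the [mu 0 k] with weights of sum 1, so that
positivity does not depend on the diagonalization. *)
Lemma diag_gt0 U V l mu i : U \is unitarymx -> V \is unitarymx ->
  U^t* *m diag_mx l *m U = V^t* *m diag_mx mu *m V ->
  (forall k, 0 < mu 0 k) -> 0 < l 0 i.
Proof.
move=> uU uV E mu_gt0; have uUV := mul_unitary_adj uU uV.
have -> : l 0 i = \sum_k mu 0 k * `|(U *m V^t*) i k| ^+ 2.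
  rewrite -diag_conj_entry -conj_adj_diag_unitary -E conj_adj_diag //.
  by rewrite mxE eqxx mulr1n.
have ge0 k : 0 <= mu 0 k * `|(U *m V^t*) i k| ^+ 2.
  by rewrite mulr_ge0 ?exprn_ge0 // ltW.
rewrite lt_def sumr_ge0 // andbT; apply/negP => /eqP.
move=> /psumr_eq0P => /(_ (fun k _ => ge0 k)) Q0.
have := unitary_row_norm i uUV.
rewrite big1 => [/eqP|k _]; first by rewrite eq_sym oner_eq0.
by have /eqP := Q0 k isT; rewrite mulf_eq0 gt_eqF //= => /eqP.
Qed.

(** In the bases that diagonalize its two terms, a difference of two normal
matrices becomes an entrywise multiple of the change of basis. *)
Lemma conj_sub_diag_entry U V l mu i j : U \is unitarymx -> V \is unitarymx ->
  (U *m (U^t* *m diag_mx l *m U - V^t* *m diag_mx mu *m V) *m V^t*) i j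
  = (l 0 i - mu 0 j) * (U *m V^t*) i j.
Proof.
move=> /unitarymxP U1 /unitarymxP V1; rewrite mulmxBr mulmxBl !mulmxA U1 mul1mx.
rewrite -[X in _ - X]mulmxA V1 mulmx1 -[X in X - _]mulmxA mul_diag_mx mul_mx_diag.
by rewrite !mxE mulrBl [X in _ - X]mulrC.
Qed.

Lemma hermitian_diagonalization M : M^t* = M -> exists W l,
  [/\ W \is unitarymx, forall i, l 0 i \is Num.real &
      M = W^t* *m diag_mx l *m W].
Proof.
move=> hM; have hermM : M \is hermsymmx.
  by apply/is_hermitianmxP; rewrite expr0 scale1r hM.
exists (spectralmx M), (spectral_diag M); split => [|i|].
- exact: spectral_unitarymx.
- exact: (mxOverP (hermitian_spectral_diag_real hermM)).
- have /orthomx_spectralP := hermitian_normalmx hermM.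
  by rewrite invmx_unitary // spectral_unitarymx.
Qed.

End UnitaryDiagonalization.

(** * Tensors as matrices *)

(** [R[i]] under a name that is not unfolded by simplification, so that its
algebraic structures are the ones derived from [numClosedFieldType]. *)
Definition complex_field (R : realType) : numClosedFieldType := R[i].
Arguments complex_field : simpl never.

Section TensorMatrix.
Context {R : realType} {N : nat} (I : 'I_N -> nat).
Local Notation D := (tensor_dim I).
Local Notation C := (complex_field R).
Local Notation multi_index := (multi_index I).
Local Open Scope sesquilinear_scope.

Lemma card_multi_index : #|{: multi_index}| = D.
Proof.
rewrite card_dep_ffun /tensor_dim -[RHS]big_enum /=.
rewrite /image_mem foldrE big_map.
by apply: eq_bigr => k _; rewrite card_ord.
Qed.

Definition index_of (i : 'I_D) : multi_index :=
  enum_val (cast_ord (esym card_multi_index) i).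

Lemma index_of_bij : bijective index_of.
Proof.
exists (fun a => cast_ord card_multi_index (enum_rank a)) => [i|a].
  by rewrite /index_of enum_valK cast_ordKV.
by rewrite /index_of cast_ordK enum_rankK.
Qed.

Lemma sum_index_of (V : nmodType) (F : multi_index -> V) :
  \sum_a F a = \sum_i F (index_of i).
Proof. by rewrite (reindex index_of) //; exact/onW_bij/index_of_bij. Qed.

Definition tensor_mx (X : tensor R I) : 'M[C]_D :=
  \matrix_(i, j) X (index_of i, index_of j).

Lemma tensor_mx_inj : injective tensor_mx.
Proof.
move=> X Y /matrixP E; apply/ffunP => -[a b].
by have [g _ gK] := index_of_bij; have := E (g a) (g b); rewrite !mxE !gK.
Qed.

Lemma tensor_mxB X Y : tensor_mx (X - Y) = tensor_mx X - tensor_mx Y.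
Proof. by apply/matrixP => i j; rewrite !mxE !ffunE. Qed.

Lemma tensor_mx_mul X Y :
  tensor_mx (einstein_mul X Y) = tensor_mx X *m tensor_mx Y.
Proof.
apply/matrixP => i j; rewrite !mxE ffunE /= sum_index_of.
by apply: eq_bigr => k _; rewrite !mxE.
Qed.

Lemma tensor_mx_id : tensor_mx (tensor_id I) = 1%:M.
Proof.
by apply/matrixP => i j; rewrite !mxE ffunE /= (bij_eq index_of_bij).
Qed.

Lemma conjcE (z : C) : (z^*)%C = Num.conj z.
Proof. by []. Qed.

Lemma tensor_mx_adj X : tensor_mx (tensor_adj X) = (tensor_mx X)^t*.
Proof. by apply/matrixP => i j; rewrite !mxE ffunE /=. Qed.

(** The rows are the conjugates of the columns [U i], so that a spectral sum
takes the form [W^t* *m diag_mx l *m W]. *)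
Definition row_matrix (U : 'I_D -> tensor_col I) : 'M[C]_D :=
  \matrix_(i, j) Num.conj (U i (index_of j) : C).

Lemma orthonormal_colsP U :
  orthonormal_cols U <-> row_matrix U \is unitarymx.
Proof.
have E i j : (row_matrix U *m (row_matrix U)^t*) i j
    = \sum_a ((U i a)^*)%C * U j a.
  rewrite mxE sum_index_of; apply: eq_bigr => k _.
  by rewrite !mxE conjCK conjcE.
split => [oU|/unitarymxP oU i j].
  by apply/unitarymxP/matrixP => i j; rewrite E oU !mxE.
by rewrite -E oU !mxE.
Qed.

Definition real_row (n : nat) (l : 'I_n -> R) : 'rV[C]_n := \row_i (l i)%:C%C.

Lemma tensor_mx_spectral_sum f (e : eigen_data I) :
  tensor_mx (spectral_sum f e) =
  (row_matrix e.2)^t* *m diag_mx (real_row (fun i => f (e.1 i))) *m row_matrix e.2.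
Proof.
apply/matrixP => i j; rewrite mxE /spectral_sum sum_ffunE mxE.
apply: eq_bigr => k _; rewrite mul_mx_diag !mxE conjCK.
rewrite !ffunE /= conjcE -[_ *: _]/(_ * _).
by rewrite mulrCA mulrA.
Qed.

Lemma eigen_decomposition_exists (H : tensor R I) :
  hermitian_tensor H -> exists e, eigen_decomposition H e.
Proof.
move=> hH; set M := tensor_mx H.
have hM : M^t* = M by rewrite -tensor_mx_adj hH.
have [Q [l [uQ l_real EM]]] := hermitian_diagonalization hM.
pose U (i : 'I_D) : tensor_col I :=
  [ffun a => Num.conj (Q i (cast_ord card_multi_index (enum_rank a)))].
have EU : row_matrix U = Q.
  apply/matrixP => i j; rewrite !mxE ffunE conjCK.
  by rewrite /index_of enum_valK cast_ordKV.
exists ((fun i => complex.Re (l 0 i)), U); split.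
  by apply/orthonormal_colsP; rewrite EU.
apply: tensor_mx_inj; rewrite tensor_mx_spectral_sum [row_matrix _]EU -/M EM.
congr (_ *m diag_mx _ *m _).
by apply/rowP => i; rewrite mxE; apply/esym/RRe_real/l_real.
Qed.

Lemma eigen_ofP (H : tensor R I) :
  hermitian_tensor H -> eigen_decomposition H (eigen_of H).
Proof. by move=> /eigen_decomposition_exists [e He]; exact: (xgetI _ He). Qed.

End TensorMatrix.

(** * Functional calculus and the spectral norm *)

Section SpectralNorm.
Context {R : realType} {N : nat} (I : 'I_N -> nat).
Local Notation D := (tensor_dim I).
Local Notation C := (complex_field R).
Local Open Scope sesquilinear_scope.
Implicit Types (X : tensor R I) (e : @eigen_data R N I).

Lemma spectral_sumM f g e : orthonormal_cols e.2 ->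
  einstein_mul (spectral_sum f e) (spectral_sum g e) =
  spectral_sum (fun x => f x * g x) e.
Proof.
move=> /orthonormal_colsP U1; apply: tensor_mx_inj.
rewrite tensor_mx_mul !tensor_mx_spectral_sum (adj_diagM _ _ U1) mulmx_diag.
by congr (_ *m diag_mx _ *m _); apply/rowP => i; rewrite !mxE rmorphM.
Qed.

Lemma spectral_sum1 e : orthonormal_cols e.2 ->
  spectral_sum (fun=> 1) e = tensor_id I.
Proof.
move=> /orthonormal_colsP U1; apply: tensor_mx_inj.
rewrite tensor_mx_spectral_sum tensor_mx_id.
rewrite (_ : diag_mx _ = 1%:M) ?mulmx1 ?unitary_adjmul //.
by apply/matrixP => i j; rewrite !mxE.
Qed.

Lemma tensor_exp_spectral X e n : eigen_decomposition X e ->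
  tensor_exp X n = spectral_sum (fun x => x ^+ n) e.
Proof.
move=> [oe eX]; elim: n => [|n IHn].
  by rewrite (spectral_sum1 oe).
rewrite /tensor_exp iterS -/(tensor_exp X n) IHn {1}eX (spectral_sumM _ _ oe).
by congr spectral_sum; apply/funext => x; rewrite exprS.
Qed.

Lemma gram_hermitian X : hermitian_tensor (einstein_mul (tensor_adj X) X).
Proof.
apply: tensor_mx_inj.
by rewrite tensor_mx_adj tensor_mx_mul tensor_mx_adj adjM trmxCK.
Qed.

Definition gram_eigen X := eigenvalue_of (einstein_mul (tensor_adj X) X).

Lemma gram_decomposition X : exists2 W, W \is unitarymx &
  (tensor_mx X)^t* *m tensor_mx X = W^t* *m diag_mx (real_row (gram_eigen X)) *m W.
Proof.
have [/orthonormal_colsP oe E] := eigen_ofP (gram_hermitian X).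
exists (row_matrix (eigen_of (einstein_mul (tensor_adj X) X)).2) => //.
by rewrite -tensor_mx_adj -tensor_mx_mul {1}E tensor_mx_spectral_sum.
Qed.

Lemma gram_eigen_ge0 X i : 0 <= gram_eigen X i.
Proof.
have [W uW E] := gram_decomposition X.
by have := gram_diag_ge0 i uW E; rewrite mxE ler0c.
Qed.

Lemma spectral_norm_ge0 X : 0 <= spectral_norm X.
Proof. exact: bigmax_ge_id. Qed.

Lemma gram_eigen_le X i : gram_eigen X i <= spectral_norm X ^+ 2.
Proof.
rewrite -(sqr_sqrtr (gram_eigen_ge0 X i)).
rewrite ler_sqr ?nnegrE ?sqrtr_ge0 ?spectral_norm_ge0 //.
exact: (le_bigmax _ (singular_value X) i).
Qed.

Lemma normc_ge0 (z : C) : 0 <= Normc.normc z.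
Proof. by case: z => a b; exact: sqrtr_ge0. Qed.

(** The converse estimate, up to the factor [D], is [spectral_norm_le_entries]. *)
Lemma entry_le_spectral_norm X (U V : 'M[C]_D) i j :
  U \is unitarymx -> V \is unitarymx ->
  Normc.normc ((U *m tensor_mx X *m V^t*) i j) <= spectral_norm X.
Proof.
move=> uU uV; have [W uW E] := gram_decomposition X.
rewrite -ler_sqr ?nnegrE ?spectral_norm_ge0 ?normc_ge0 //.
rewrite -lecR rmorphXn /=.
apply: (entry_le_gram_diag _ _ uU uV uW E) => k.
by rewrite mxE lecR gram_eigen_le.
Qed.

(** The spectral norm is at most the Frobenius norm, computed in any two
orthonormal bases. *)
Lemma spectral_norm_le_entries X (U V : 'M[C]_D) (k : R) :
  U \is unitarymx -> V \is unitarymx -> 0 <= k ->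
  (forall i j, Normc.normc ((U *m tensor_mx X *m V^t*) i j) <= k) ->
  spectral_norm X <= D%:R * k.
Proof.
move=> uU uV k0 hk; apply/bigmax_leP; split => [|i _]; first by rewrite mulr_ge0.
have [W uW E] := gram_decomposition X.
rewrite /singular_value -/(gram_eigen X i).
rewrite -[leRHS]ger0_norm ?mulr_ge0 // -sqrtr_sqr; apply: ler_wsqrtr.
have := gram_diag_le_entries i uU uV uW E; rewrite mxE => mu_le.
rewrite -lecR; apply: (le_trans mu_le).
have -> : ((D%:R * k) ^+ 2)%:C%C = \sum_(j < D) \sum_(i < D) (k ^+ 2)%:C%C :> R[i].
  rewrite !sumr_const !card_ord -mulrnA -rmorphMn /=; congr (_ %:C)%C.
  by rewrite exprMn -natrX mulr_natl mulnn.
apply: ler_sum => a _; apply: ler_sum => b _.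
rewrite -[`|_|]/((Normc.normc _)%:C%C) -rmorphXn lecR.
by rewrite ler_sqr ?nnegrE ?normc_ge0.
Qed.

(** The definition provides some decomposition with positive eigenvalues, whereas
[eigen_of] may have chosen another one. *)
Lemma positive_definite_eigen X i :
  positive_definite X -> 0 < (eigen_of X).1 i.
Proof.
move=> [hX [e [oe eX] e_gt0]].
have [/orthonormal_colsP uU EX] := eigen_ofP hX.
move: oe => /orthonormal_colsP uV.
have := congr1 (@tensor_mx _ _ _) EX; rewrite {1}eX !tensor_mx_spectral_sum.
move=> /esym E; have := diag_gt0 i uU uV E.
rewrite mxE ltcR; apply => k.
by rewrite mxE ltcR.
Qed.

Lemma le1_powR_ge (p a : R) : p <= 1 -> 0 <= a -> a <= 1 -> a <= a `^ p.
Proof.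
move=> p1; rewrite le_eqVlt => /orP[/eqP <- _|a0 a1]; first exact: powR_ge0.
by rewrite ger1_powR // a0.
Qed.

(** For [y <= x], dividing by [x `^ p] reduces the claim to
[1 <= u `^ p + (1 - u) `^ p] with [u = y / x], which follows from
[u <= u `^ p] and the same inequality for [1 - u]. *)
Lemma dist_powR_le (p x y : R) : 0 <= p -> p <= 1 -> 0 <= x -> 0 <= y ->
  `|x `^ p - y `^ p| <= `|x - y| `^ p.
Proof.
move=> p0 p1.
wlog yx : x y / y <= x.
  move=> H x0 y0; have [yx|/ltW xy] := leP y x; first exact: H.
  by rewrite distrC [in leRHS]distrC; exact: H.
move=> x0 y0.
have d0 : 0 <= x - y by rewrite subr_ge0.
rewrite (ger0_norm d0) ger0_norm; last by rewrite subr_ge0 ge0_ler_powR.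
have [x_gt0|] := ltP 0 x; last first.
  move=> xle0; have y00 : y = 0 by apply/le_anti; rewrite y0 (le_trans yx).
  by rewrite y00 (le_anti (introT andP (conj xle0 x0))) !subrr powR_ge0.
have split_powR a : 0 <= a -> a `^ p = x `^ p * (a / x) `^ p.
  move=> a0; rewrite -powRM ?divr_ge0 //.
  by rewrite mulrC divfK // gt_eqF.
rewrite lerBlDl (split_powR y) // (split_powR (x - y)) // -mulrDr.
rewrite ler_peMr ?powR_ge0 //.
have -> : 1 = y / x + (x - y) / x.
  by rewrite -mulrDl addrC subrK divff // gt_eqF.
apply: lerD; apply: le1_powR_ge; rewrite ?divr_ge0 // ler_pdivrMr // mul1r //.
by rewrite gerBl.
Qed.

(** The mixed entries of the left-hand side are
[(x `^ w - y `^ w) * <u_i, v_j>] with [x] and [y] eigenvalues of the powers of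
[A] and [B]; the factor [D] is the price of passing from entries to the norm. *)
Lemma spectral_norm_powR_le (A B : tensor R I) (m n : nat) (w : R) :
  positive_definite A -> positive_definite B -> 0 <= w -> w <= 1 ->
  spectral_norm (tensor_powR A (n%:R * w) - tensor_powR B (m%:R * w))
  <= D%:R * spectral_norm (tensor_exp A n - tensor_exp B m) `^ w.
Proof.
move=> pA pB w0 w1.
have eA := eigen_ofP pA.1; have eB := eigen_ofP pB.1.
have lA i := positive_definite_eigen i pA.
have lB i := positive_definite_eigen i pB.
rewrite (tensor_exp_spectral n eA) (tensor_exp_spectral m eB) /tensor_powR.
move: eA eB => [oA _] [oB _].
have uA := (orthonormal_colsP _).1 oA; have uB := (orthonormal_colsP _).1 oB.
set U := row_matrix _ in uA; set V := row_matrix _ in uB.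
have entry f g i j : (U *m tensor_mx (spectral_sum f (eigen_of A) -
      spectral_sum g (eigen_of B)) *m V^t*) i j =
    (f ((eigen_of A).1 i) - g ((eigen_of B).1 j))%:C%C * (U *m V^t*) i j.
  rewrite tensor_mxB !tensor_mx_spectral_sum conj_sub_diag_entry //.
  by rewrite !mxE rmorphB.
set s := spectral_norm _.
apply: (spectral_norm_le_entries uA uB) => [|i j]; first exact: powR_ge0.
have := entry_le_spectral_norm (spectral_sum (fun x => x ^+ n) (eigen_of A) -
    spectral_sum (fun x => x ^+ m) (eigen_of B)) i j uA uB.
rewrite !entry -/s.
set x := (eigen_of A).1 i; set y := (eigen_of B).1 j.
have x0 : 0 < x by exact: lA.
have y0 : 0 < y by exact: lB.
have r1 : Normc.normc ((U *m V^t*) i j) <= 1.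
  by rewrite -lecR; exact: (unitary_entry_le1 i j (mul_unitary_adj uA uB)).
have normRC (k : R) : Normc.normc (k%:C%C : C) = `|k|.
  by rewrite /= expr0n addr0 sqrtr_sqr.
rewrite !Normc.normcM !normRC.
move: r1 (normc_ge0 ((U *m V^t*) i j)); set r := Normc.normc _ => r1 r0 hs.
rewrite !powRrM !powR_mulrn ?(ltW x0) ?(ltW y0) //.
apply: (@le_trans _ _ ((`|x ^+ n - y ^+ m| * r) `^ w)); last first.
  by rewrite ge0_ler_powR // nnegrE ?mulr_ge0 ?spectral_norm_ge0.
rewrite powRM // ler_pM //; last exact: le1_powR_ge.
by apply: dist_powR_le => //; rewrite exprn_ge0 // ltW.
Qed.

End SpectralNorm.

(** * A pointwise bound by L2 norms *)

Section PointwiseBound.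
Context {R : realType}.
Local Notation mu := (@lebesgue_measure R).

(** Cauchy-Schwarz against the indicator function of an interval of length [a]. *)
Lemma L1_itv_le_L2 (f : R -> R) (t a : R) : 0 <= a -> measurable_fun setT f ->
  (\int[mu]_(x in `[t, (t + a)%R]) `|f x|%:E <= (Num.sqrt a)%:E * L2norm f)%E.
Proof.
move=> a0 mf; set J := `[t, t + a]%classic.
have mJ : measurable J by exact: measurable_itv.
have two : (2^-1 + 2^-1 = 1 :> R)%R by lra.
have mind : measurable_fun setT (\1_J : R -> R) by exact: measurable_indic.
have := @hoelder _ _ _ mu _ _ _ _ mf mind (ltr0Sn _ 1) (ltr0Sn _ 1) two.
have -> : ('N[mu]_2%:E[EFin \o (\1_J : R -> R)] = (Num.sqrt a)%:E)%E.
  rewrite unlock /=.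
  have -> : (\int[mu]_x (`|(\1_J x)%:E| `^ 2) = mu J)%E.
    rewrite -[in RHS](setIT J) -integral_indic //.
    apply: eq_integral => x _ /=; rewrite indicE.
    by case: (_ \in _); rewrite /= ?normr1 ?normr0 ?powR1 ?powR0.
  rewrite lebesgue_measure_itv /= lte_fin ltrDl.
  have [a_gt0|] := ltP 0 a; last first.
    move=> a_le0; have -> : a = 0 by apply/le_anti; rewrite a0 a_le0.
    by rewrite sqrtr0 poweR_EFin powR0 // invr_eq0.
  by rewrite -EFinB addrAC subrr add0r poweR_EFin powR12_sqrt.
rewrite muleC; apply: le_trans.
rewrite Lnorm1 [X in (X <= _)%E]integral_mkcond le_eqVlt.
apply/orP; left; apply/eqP.
apply: eq_integral => x _; rewrite patchE /= indicE.
by case: (_ \in _); rewrite ?mulr1 ?mulr0 ?normr0.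
Qed.

(** Sobolev inequality in dimension one: integrate from [t] to
[t + a] the derivative of [F x = (t + a - x) * g x], which vanishes at the
right end. *)
Lemma point_le_L2 (g : R -> R) (t a : R) : 0 < a ->
  measurable_fun setT g -> measurable_fun setT (derive1 g) ->
  {in `[t, t + a], forall x, derivable g x 1} ->
  {within `[t, t + a], continuous (derive1 g)} ->
  ((a * g t)%:E <= (Num.sqrt a)%:E * L2norm g
                   + (a * Num.sqrt a)%:E * L2norm (derive1 g))%E.
Proof.
move=> a0 mg mg' dg cg'.
have tta : t < t + a by rewrite ltrDl.
pose h x := (t + a - x) * (derive1 g) x - g x.
pose F x := (t + a - x) * g x.
set J := `[t, t + a]%classic.
have cg : {within J, continuous g} by exact: derivable_within_continuous.
have dF x : x \in `[t, t + a] -> is_derive x 1 F (h x).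
  move=> xJ; have gx : is_derive x 1 g ((derive1 g) x).
    by rewrite derive1E; apply/derivableP/dg.
  apply: is_derive_eq; rewrite /h /GRing.scale /=; ring.
have cF : {within J, continuous F}.
  by apply: derivable_within_continuous => x xJ; have [] := dF x xJ.
have ch : {within J, continuous h}.
  have -> : h = ((fun x => t + a - x) \* derive1 g) - g by apply/funext.
  apply: within_continuousB cg => x; apply: continuousM (cg' x).
  apply: continuous_subspaceT => {}x.
  by apply: cvgB; [exact: cvg_cst|exact: cvg_id].
have FTC : (\int[mu]_(x in J) (h x)%:E = (F (t + a))%:E - (F t)%:E)%E.
  apply: (continuous_FTC2 tta ch).
  - have [_ Ft Fta] := (continuous_within_itvP _ tta).1 cF.
    split; [|exact: Ft|exact: Fta] => x xJ.
    by have [] := dF x (subset_itv_oo_cc xJ).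
  - move=> x xJ; rewrite derive1E.
    by have [_ ->] := dF x (subset_itv_oo_cc xJ).
have mh : measurable_fun setT h.
  apply: measurable_funB => //; apply: measurable_funM => //.
  by apply: measurable_funB => //; exact: measurable_id.
have mJ : measurable J by exact: measurable_itv.
have absM (f : R -> R) : measurable_fun setT f ->
    measurable_fun J (fun x => `|f x|%:E : \bar R).
  move=> mf; apply/measurable_EFinP; apply: measurableT_comp => //.
  exact: measurable_funS mf.
apply: (@le_trans _ _ (\int[mu]_(x in J) (`|g x|%:E + a%:E * `|(derive1 g) x|%:E)))%E.
  apply: (@le_trans _ _ `|\int[mu]_(x in J) (h x)%:E|%E).
    rewrite FTC /F subrr mul0r sub0e abseN /= lee_fin addrAC subrr add0r.
    exact: ler_norm.
  apply: (@le_trans _ _ (\int[mu]_(x in J) `|(h x)%:E|)%E).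
    apply: le_abse_integral => //.
    by apply/measurable_EFinP; exact: measurable_funS mh.
  apply: ge0_le_integral => //.
  - exact: absM.
  - apply: emeasurable_funD; first exact: absM.
    by apply: emeasurable_funM => //; exact: absM.
  - move=> x; rewrite /J /= in_itv /= => /andP[tx xta].
    rewrite -EFinM -EFinD lee_fin /h [leRHS]addrC.
    rewrite (le_trans (ler_normB _ _)) // lerD2r normrM ler_wpM2r //.
    by rewrite ger0_norm ?subr_ge0 // lerBlDr addrC lerD2l.
have ag'_ge0 x : (0 <= a%:E * `|derive1 g x|%:E :> \bar R)%E.
  by apply: mule_ge0; rewrite lee_fin // ltW.
rewrite ge0_integralD //; last 2 first.
- exact: absM.
- by apply: emeasurable_funM => //; exact: absM.
rewrite ge0_integralZl_EFin; [|by []|by []|exact: absM|exact: ltW].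
rewrite EFinM -muleA.
apply: leeD; first exact: L1_itv_le_L2 (ltW a0) mg.
rewrite lee_pmul2l ?lte_fin //; exact: L1_itv_le_L2 (ltW a0) mg'.
Qed.

End PointwiseBound.

(** * The minimum of the scalar bound *)

Section GBound.
Context {R : realType}.
Implicit Types k t w c s : R.

(** Twice the hyperbolic sine and cosine of [k * t]. *)
Definition sinh2 k t := expR (k * t) - expR (- k * t).
Definition cosh2 k t := expR (k * t) + expR (- k * t).

Lemma is_derive_expR_scale k t :
  is_derive t 1 (fun t => expR (k * t)) (k * expR (k * t)).
Proof.
rewrite [X in is_derive _ _ _ X]mulrC; apply: (@is_derive1_comp R expR).
by apply: is_derive_eq; rewrite /GRing.scale /= mulr1.
Qed.

Lemma is_derive_sinh2 k t : is_derive t 1 (sinh2 k) (k * cosh2 k t).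
Proof.
have ? := is_derive_expR_scale k t; have ? := is_derive_expR_scale (- k) t.
by apply: is_derive_eq; rewrite /cosh2; ring.
Qed.

Lemma is_derive_cosh2 k t : is_derive t 1 (cosh2 k) (k * sinh2 k t).
Proof.
have ? := is_derive_expR_scale k t; have ? := is_derive_expR_scale (- k) t.
by apply: is_derive_eq; rewrite /sinh2; ring.
Qed.

Lemma sinh2_neq0 k t : k != 0 -> t != 0 -> sinh2 k t != 0.
Proof.
move=> k0 t0; rewrite subr_eq0; apply/negP => /eqP /expR_inj.
move=> /eqP; rewrite mulNr -addr_eq0 -mulr2n mulrn_eq0 /= mulf_eq0.
by rewrite (negbTE k0) (negbTE t0).
Qed.

Lemma sinh_ratioE w t : sinh_ratio w t = sinh2 (w / 2) t / sinh2 (1 / 2) t.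
Proof.
by rewrite /sinh_ratio /sinh2; congr ((expR _ - expR _) / (expR _ - expR _));
  ring.
Qed.

Definition sinh_ratio' w t :=
  (w / 2 * cosh2 (w / 2) t * sinh2 (1 / 2) t
   - sinh2 (w / 2) t * (1 / 2 * cosh2 (1 / 2) t)) / sinh2 (1 / 2) t ^+ 2.

Lemma is_derive_div (f g : R -> R) t (df dg : R) : g t != 0 ->
  is_derive t 1 f df -> is_derive t 1 g dg ->
  is_derive t 1 (fun x => f x / g x) ((df * g t - f t * dg) / g t ^+ 2).
Proof.
move=> g0 hf hg; have ? := is_deriveV g0 hg.
by apply: is_derive_eq; rewrite /GRing.scale /=; field.
Qed.

Lemma half_neq0 : 1 / 2 != 0 :> R.
Proof. by rewrite mul1r invr_eq0 pnatr_eq0. Qed.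

Lemma is_derive_sinh_ratio w t : t != 0 ->
  is_derive t 1 (sinh_ratio w) (sinh_ratio' w t).
Proof.
move=> t0; have -> : sinh_ratio w = fun x => sinh2 (w / 2) x / sinh2 (1 / 2) x.
  by apply/funext => x; exact: sinh_ratioE.
apply: is_derive_div; last exact: is_derive_sinh2.
  exact: sinh2_neq0 half_neq0 t0.
exact: is_derive_sinh2.
Qed.

Lemma derivable_sinh_ratio' w t : t != 0 -> derivable (sinh_ratio' w) t 1.
Proof.
move=> t0; have s0 := sinh2_neq0 half_neq0 t0.
have ? := is_derive_sinh2 (w / 2) t; have ? := is_derive_cosh2 (w / 2) t.
have ? := is_derive_sinh2 (1 / 2) t; have ? := is_derive_cosh2 (1 / 2) t.
have s20 : sinh2 (1 / 2) t ^+ 2 != 0 by rewrite expf_neq0.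
by apply: ex_derive; apply: is_derive_div.
Qed.

Lemma gfun_near w t : t != 0 -> \near t, sinh_ratio w t = gfun w t.
Proof.
move=> t0; have : \forall x \near t, x != 0.
  by apply: open_nbhs_nbhs; split => //; exact: open_neq.
by apply: filterS => x x0; rewrite /gfun (negbTE x0).
Qed.

Lemma derivable_gfun w t : t != 0 -> derivable (gfun w) t 1.
Proof.
move=> t0; apply: near_eq_derivable (gfun_near w t0) _.
by have [] := is_derive_sinh_ratio w t0.
Qed.

Lemma derive1_gfun w t : t != 0 -> derive1 (gfun w) t = sinh_ratio' w t.
Proof.
move=> t0; rewrite derive1E -(near_eq_derive _ (gfun_near w t0)).
by have [_ ->] := is_derive_sinh_ratio w t0.
Qed.

Lemma derivable_derive1_gfun w t : t != 0 -> derivable (derive1 (gfun w)) t 1.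
Proof.
move=> t0; have E : \near t, sinh_ratio' w t = derive1 (gfun w) t.
  have : \forall x \near t, x != 0.
    by apply: open_nbhs_nbhs; split => //; exact: open_neq.
  by apply: filterS => x x0; rewrite derive1_gfun.
apply: near_eq_derivable E _; exact: derivable_sinh_ratio'.
Qed.

Lemma measurable_fun_derivable_off0 (f : R -> R) :
  (forall t, t != 0 -> derivable f t 1) -> measurable_fun setT f.
Proof.
move=> df; rewrite -(setUv [set 0]); apply/measurable_funU => //.
  exact: measurableC.
split; first exact: measurable_fun_set1.
apply: open_continuous_measurable_fun.
  by rewrite openC; exact: closed_eq.
move=> t /[!inE] /= /eqP t0.
exact/differentiable_continuous/derivable1_diffP/df.
Qed.

Lemma sinh2_ge k t : 0 <= k -> 0 <= t -> 2 * k * t * expR (- k * t) <= sinh2 k t.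
Proof.
move=> k0 t0; have -> : sinh2 k t = (expR (2 * k * t) - 1) * expR (- k * t).
  by rewrite mulrBl mul1r -expRD /sinh2; congr (expR _ - _); ring.
rewrite ler_wpM2r ?expR_ge0 // lerBrDl; exact: expR_ge1Dx.
Qed.

Lemma sinh2_le k t : sinh2 k t <= 2 * k * t * expR (k * t).
Proof.
have -> : sinh2 k t = (1 - expR (- (2 * k * t))) * expR (k * t).
  by rewrite mulrBl mul1r -expRD /sinh2; congr (_ - expR _); ring.
rewrite ler_wpM2r ?expR_ge0 // lerBlDl.
by have := expR_ge1Dx (- (2 * k * t)); lra.
Qed.

(** Elementary substitute for the limit [w] of the ratio at [0]; it is used for
small [t]. *)
Lemma gfun_ge w t : 0 <= w -> w <= 1 -> 0 < t -> w * (1 - t) <= gfun w t.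
Proof.
move=> w0 w1 t0; rewrite /gfun gt_eqF // sinh_ratioE.
have s_gt0 : 0 < sinh2 (1 / 2) t.
  by rewrite subr_gt0 ltr_expR; nra.
rewrite ler_pdivlMr //.
have w20 : 0 <= w / 2 by lra.
apply: (le_trans _ (sinh2_ge w20 (ltW t0))).
have exp_le : 1 - t <= expR (- (w / 2) * t) * expR (- (1 / 2 * t)).
  rewrite -expRD; have := expR_ge1Dx (- t); move=> /le_trans -> //.
  by rewrite ler_expR; nra.
have [t_gt1|t_le1] := ltP 1 t.
  apply: (@le_trans _ _ 0); last by rewrite !mulr_ge0 ?expR_ge0 // ltW.
  by rewrite mulr_le0_ge0 ?(ltW s_gt0) // mulr_ge0_le0 //; lra.
apply: (@le_trans _ _ (w * (1 - t) * (2 * (1 / 2) * t * expR (1 / 2 * t)))).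
  by rewrite ler_wpM2l ?sinh2_le // mulr_ge0 //; lra.
have e_gt0 := expR_gt0 (1 / 2 * t).
rewrite expRN ler_pdivlMr // in exp_le.
have -> : w * (1 - t) * (2 * (1 / 2) * t * expR (1 / 2 * t))
    = w * t * ((1 - t) * expR (1 / 2 * t)) by field.
have -> : 2 * (w / 2) * t * expR (- (w / 2) * t)
    = w * t * expR (- (w / 2) * t) by field.
by rewrite ler_wpM2l // mulr_ge0 // ltW.
Qed.

(** The pointwise bound on an interval of length [a = 1 / (2 * c)] that lies to
the right of the singular point [0] of the formula for [gfun]. *)
Lemma gfun_le_g_bound w c t : 0 < c -> 0 < t ->
  ((gfun w t)%:E <= g_bound w c)%E.
Proof.
move=> c0 t0; pose s := Num.sqrt (2 * c).
have s0 : 0 < s by rewrite sqrtr_gt0; lra.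
have a0 : 0 < s ^- 2 by rewrite invr_gt0 exprn_gt0.
have neq0 x : x \in `[t, t + s ^- 2] -> x != 0.
  by rewrite in_itv /= => /andP[tx _]; rewrite gt_eqF // (lt_le_trans t0).
have mg := measurable_fun_derivable_off0 (@derivable_gfun w).
have mg' := measurable_fun_derivable_off0 (@derivable_derive1_gfun w).
have cg' : {within `[t, t + s ^- 2], continuous (derive1 (gfun w))}.
  apply: derivable_within_continuous => x /neq0; exact: derivable_derive1_gfun.
have dg : {in `[t, t + s ^- 2], forall x, derivable (gfun w) x 1}.
  by move=> x /neq0; exact: derivable_gfun.
have := point_le_L2 a0 mg mg' dg cg'.
have -> : Num.sqrt (s ^- 2) = s^-1.
  by rewrite -exprVn sqrtr_sqr gtr0_norm ?invr_gt0.
have s2_gt0 : (0 < (s ^+ 2)%:E :> \bar R)%E by rewrite lte_fin exprn_gt0.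
rewrite -(lee_pmul2l _ s2_gt0) // ge0_muleDr; last 2 first.
- by rewrite mule_ge0 ?Lnorm_ge0 // lee_fin invr_ge0 ltW.
- by rewrite mule_ge0 ?Lnorm_ge0 // lee_fin mulr_ge0 ?invr_ge0 // ltW.
have s2N0 : s ^+ 2 != 0 by rewrite expf_neq0 // gt_eqF.
rewrite !muleA -!EFinM mulVKf //.
have -> : s ^+ 2 / s = s by rewrite expr2 mulfK // gt_eqF.
have -> : s ^+ 2 * (s ^- 2 / s) = s^-1 by rewrite mulrA mulfV // mul1r.
move=> /le_trans; apply.
rewrite /g_bound -/s leeD2l // lee_wpmul2r ?Lnorm_ge0 // lee_fin.
rewrite /s -sqrtrV ?mulr_ge0 ?(ltW c0) //; apply: ler_wsqrtr.
rewrite invfM.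
by rewrite ler_wpM2r ?invr_ge0 ?(ltW c0) //; lra.
Qed.

Lemma g_bound_ge w c : 0 < w -> w <= 1 -> 0 < c -> (w%:E <= g_bound w c)%E.
Proof.
move=> w0 w1 c0; apply/lee_addgt0Pr => e e0.
have t0 : 0 < e / w by rewrite divr_gt0.
rewrite -leeBlDr //; apply: le_trans (gfun_le_g_bound w c0 t0).
rewrite -EFinB lee_fin; apply: le_trans (gfun_ge (ltW w0) w1 t0).
by rewrite mulrBr mulr1 mulrCA divff ?mulr1 // gt_eqF.
Qed.

(** The hypothesis forces [x] and [y] to be positive, by letting [s] tend to
infinity or to [0]; the arithmetic-geometric mean inequality then puts the
minimum at [s ^+ 2 = 2 * y / x]. *)
Lemma min_weighted_sum (x y w : R) : 0 < w -> 0 <= x -> 0 <= y ->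
  (forall s, 0 < s -> w <= s * x + 2 / s * y) ->
  exists2 s, 0 < s &
    forall r, 0 < r -> s * x + 2 / s * y <= r * x + 2 / r * y.
Proof.
move=> w0 x0 y0 w_le.
have x_gt0 : 0 < x.
  rewrite lt_def x0 andbT; apply/negP => /eqP xE.
  have s0 : 0 < (2 * y + 1) / w by rewrite divr_gt0 //; lra.
  have := w_le _ s0; rewrite xE mulr0 add0r.
  have -> : 2 / ((2 * y + 1) / w) * y = w * (2 * y) / (2 * y + 1).
    by field; rewrite gt_eqF //=; lra.
  by rewrite ler_pdivlMr; nra.
have y_gt0 : 0 < y.
  rewrite lt_def y0 andbT; apply/negP => /eqP yE.
  have s0 : 0 < w / (x + 1) by rewrite divr_gt0 //; lra.
  have := w_le _ s0; rewrite yE mulr0 addr0.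
  have -> : w / (x + 1) * x = w * x / (x + 1) by field; lra.
  by rewrite ler_pdivlMr; nra.
pose s := Num.sqrt (2 * y / x).
have s0 : 0 < s by rewrite sqrtr_gt0 divr_gt0 //; lra.
have yE : 2 * y = s ^+ 2 * x.
  by rewrite sqr_sqrtr ?divfK ?gt_eqF // divr_ge0 //; lra.
have E r : 2 / r * y = s ^+ 2 * x / r by rewrite -yE; ring.
exists s => // r r0; rewrite !E -subr_ge0.
have -> : r * x + s ^+ 2 * x / r - (s * x + s ^+ 2 * x / s)
    = x * (r - s) ^+ 2 / r by field; rewrite !gt_eqF.
by apply: divr_ge0 (ltW r0); apply: mulr_ge0 x0 (sqr_ge0 _).
Qed.

(** With [s = Num.sqrt (2 * c)] the bound reads [s * X + 2 / s * Y].  If one of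
the norms [X], [Y] is infinite then so is every value; otherwise the lower
bound [w] makes [min_weighted_sum] applicable. *)
Lemma g_bound_min w : 0 < w -> w <= 1 ->
  exists2 M, is_minimum [set g_bound w c | c in [set c : R | 0 < c]] M &
    (w%:E <= M)%E.
Proof.
move=> w0 w1.
have min_at c : 0 < c -> (forall c', 0 < c' -> (g_bound w c <= g_bound w c')%E) ->
    exists2 M, is_minimum [set g_bound w c | c in [set c : R | 0 < c]] M &
    (w%:E <= M)%E.
  move=> c0 c_min; exists (g_bound w c); last exact: g_bound_ge.
  by split; [exists c|move=> _ [c' /= c'0 <-]; exact: c_min].
have X0 : (0 <= L2norm (gfun w))%E by exact: Lnorm_ge0.
have Y0 : (0 <= L2norm (derive1 (gfun w)))%E by exact: Lnorm_ge0.
have g_boundE s : 0 < s -> g_bound w (s ^+ 2 / 2) =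
    (s%:E * L2norm (gfun w) + (2 / s)%:E * L2norm (derive1 (gfun w)))%E.
  move=> s0; rewrite /g_bound mulrC divfK // sqrtr_sqr gtr0_norm //.
  have -> : 2 / (s ^+ 2 / 2) = (2 / s) ^+ 2 by field; rewrite gt_eqF.
  by rewrite sqrtr_sqr gtr0_norm // divr_gt0.
have sqE c : 0 < c -> c = Num.sqrt (2 * c) ^+ 2 / 2.
  by move=> c0; rewrite sqr_sqrtr ?mulr_ge0 ?(ltW c0) // mulrC mulKf.
have sq_gt0 c : 0 < c -> 0 < Num.sqrt (2 * c).
  by move=> c0; rewrite sqrtr_gt0 mulr_gt0.
move: g_boundE (fun c => @g_bound_ge w c w0 w1).
case: (L2norm (gfun w)) X0 => [x||//] X0; last first.
  move=> g_boundE _; apply: (min_at (1 ^+ 2 / 2)) => [|c c0]; first by lra.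
  rewrite (sqE c) // !g_boundE ?sq_gt0 //.
  by rewrite !gt0_muley ?lte_fin ?sq_gt0 // !addye // -ltNye
    (lt_le_trans _ (mule_ge0 _ Y0)) // lee_fin divr_ge0 // ltW // sq_gt0.
case: (L2norm (derive1 (gfun w))) Y0 => [y||//] Y0; last first.
  move=> g_boundE _; apply: (min_at (1 ^+ 2 / 2)) => [|c c0]; first by lra.
  rewrite (sqE c) // !g_boundE ?sq_gt0 //.
  by rewrite !gt0_muley ?lte_fin ?divr_gt0 ?sq_gt0.
rewrite !lee_fin in X0 Y0 => g_boundE w_le.
have [s0 s0_gt0 s_min] : exists2 s, 0 < s &
    forall r, 0 < r -> s * x + 2 / s * y <= r * x + 2 / r * y.
  apply: min_weighted_sum w0 X0 Y0 _ => s s0.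
  have := w_le (s ^+ 2 / 2); rewrite g_boundE // -!EFinM -EFinD lee_fin; apply.
  by rewrite divr_gt0 ?exprn_gt0.
apply: (min_at (s0 ^+ 2 / 2)) => [|c c0]; first by rewrite divr_gt0 ?exprn_gt0.
rewrite (sqE c) // !g_boundE ?sq_gt0 // -!EFinM -!EFinD lee_fin.
by apply: s_min; exact: sq_gt0.
Qed.

End GBound.

(** * Measurability of random tensors and of their spectral norm *)

Section ComplexParts.
Context {R : realType}.

Lemma Re_mul (z u : R[i]) : complex.Re (z * u) =
  complex.Re z * complex.Re u - complex.Im z * complex.Im u.
Proof. by case: z; case: u. Qed.

Lemma Im_mul (z u : R[i]) : complex.Im (z * u) =
  complex.Re z * complex.Im u + complex.Im z * complex.Re u.
Proof. by case: z; case: u. Qed.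

Lemma ReD (z u : R[i]) : complex.Re (z + u) = complex.Re z + complex.Re u.
Proof. by case: z; case: u. Qed.

Lemma ImD (z u : R[i]) : complex.Im (z + u) = complex.Im z + complex.Im u.
Proof. by case: z; case: u. Qed.

Lemma Re_sum (J : Type) (r : seq J) (F : J -> R[i]) :
  complex.Re (\sum_(j <- r) F j) = \sum_(j <- r) complex.Re (F j).
Proof. by elim/big_rec2: _ => // j y1 y2 _ <-; rewrite ReD. Qed.

Lemma Im_sum (J : Type) (r : seq J) (F : J -> R[i]) :
  complex.Im (\sum_(j <- r) F j) = \sum_(j <- r) complex.Im (F j).
Proof. by elim/big_rec2: _ => // j y1 y2 _ <-; rewrite ImD. Qed.

Lemma Re_scale (k : R) (z : R[i]) : complex.Re (k%:C%C * z) = k * complex.Re z.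
Proof. by rewrite Re_mul /= mul0r subr0. Qed.

Lemma Im_scale (k : R) (z : R[i]) : complex.Im (k%:C%C * z) = k * complex.Im z.
Proof. by rewrite Im_mul /= mul0r addr0. Qed.

End ComplexParts.

Section Measurability.
Context {R : realType} {d : measure_display} {T : measurableType d}.
Context {N : nat} (I : 'I_N -> nat).
Local Notation D := (tensor_dim I).
Implicit Types X Y : T -> tensor R I.

Definition complex_measurable (z : T -> R[i]) :=
  measurable_fun setT (fun t => complex.Re (z t)) /\
  measurable_fun setT (fun t => complex.Im (z t)).

Lemma complex_measurable_cst z : complex_measurable (fun=> z).
Proof. by split; exact: measurable_cst. Qed.

Lemma complex_measurableM z u : complex_measurable z -> complex_measurable u ->
  complex_measurable (fun t => z t * u t).
Proof.
move=> [zR zI] [uR uI]; split.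
  under eq_fun do rewrite Re_mul.
  by apply: measurable_funB; apply: measurable_funM.
under eq_fun do rewrite Im_mul.
by apply: measurable_funD; apply: measurable_funM.
Qed.

Lemma complex_measurableD z u : complex_measurable z -> complex_measurable u ->
  complex_measurable (fun t => z t + u t).
Proof.
move=> [zR zI] [uR uI]; split.
  by under eq_fun do rewrite ReD; exact: measurable_funD.
by under eq_fun do rewrite ImD; exact: measurable_funD.
Qed.

Lemma complex_measurable_sum (J : Type) (r : seq J) (z : J -> T -> R[i]) :
  (forall j, complex_measurable (z j)) ->
  complex_measurable (fun t => \sum_(j <- r) z j t).
Proof.
move=> mz; elim: r => [|j r IHr].
  by under eq_fun do rewrite big_nil; exact: complex_measurable_cst.
by under eq_fun do rewrite big_cons; exact: complex_measurableD.
Qed.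

Lemma random_tensorM X Y : random_tensor X -> random_tensor Y ->
  random_tensor (fun t => einstein_mul (X t) (Y t)).
Proof.
move=> rX rY p.
suff: complex_measurable (fun t => einstein_mul (X t) (Y t) p) by [].
under eq_fun do rewrite ffunE.
apply: complex_measurable_sum => j.
by apply: complex_measurableM; [exact: rX|exact: rY].
Qed.

Lemma random_tensorD X Y : random_tensor X -> random_tensor Y ->
  random_tensor (fun t => X t + Y t).
Proof.
move=> rX rY p; suff: complex_measurable (fun t => (X t + Y t) p) by [].
by under eq_fun do rewrite ffunE; exact: complex_measurableD.
Qed.

Lemma random_tensorB X Y : random_tensor X -> random_tensor Y ->
  random_tensor (fun t => X t - Y t).
Proof.
move=> rX rY p; suff: complex_measurable (fun t => (X t - Y t) p) by [].
have -> : (fun t => (X t - Y t) p) = (fun t => X t p + -1 * Y t p).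
  by apply/funext => t; rewrite !ffunE mulN1r.
apply: complex_measurableD; first exact: rX.
by apply: complex_measurableM (rY p); exact: complex_measurable_cst.
Qed.

Lemma random_tensor_cst (X : tensor R I) : random_tensor (fun _ : T => X).
Proof. by move=> p; exact: complex_measurable_cst. Qed.

Lemma random_tensorZ (k : R) X : random_tensor X ->
  random_tensor (fun t => k%:C%C *: X t).
Proof.
move=> rX p; suff: complex_measurable (fun t => (k%:C%C *: X t) p) by [].
under eq_fun do rewrite ffunE.
by apply: complex_measurableM => //; exact: complex_measurable_cst.
Qed.

Lemma random_tensor_adj X : random_tensor X ->
  random_tensor (fun t => tensor_adj (X t)).
Proof.
move=> rX p.
suff: complex_measurable (fun t => tensor_adj (X t) p) by [].
under eq_fun do rewrite ffunE.
have [rR rI] := rX (p.2, p.1); split.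
  by apply: eq_measurable_fun rR => t _; case: (X t _).
apply: eq_measurable_fun (measurable_funN rI) => t _ /=; by case: (X t _).
Qed.

Lemma random_tensor_exp X k : random_tensor X ->
  random_tensor (fun t => tensor_exp (X t) k).
Proof.
move=> rX; elim: k => [|k IHk]; first exact: random_tensor_cst.
exact: random_tensorM.
Qed.

(** The real part loses nothing on Hermitian tensors and makes the trace of a
spectral sum a real sum of eigenvalues. *)
Definition tensor_trace (Z : tensor R I) : R :=
  complex.Re (\sum_a Z (a, a)).

Lemma tensor_trace_spectral f (e : @eigen_data R N I) : orthonormal_cols e.2 ->
  tensor_trace (spectral_sum f e) = \sum_i f (e.1 i).
Proof.
move=> oe; rewrite /tensor_trace.
suff -> : \sum_a spectral_sum f e (a, a) = (\sum_i f (e.1 i))%:C%C by [].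
rewrite rmorph_sum /=.
under eq_bigr do rewrite /spectral_sum sum_ffunE.
rewrite exchange_big; apply: eq_bigr => i _ /=.
under eq_bigr do rewrite !ffunE /=.
rewrite -mulr_sumr.
have := oe i i; rewrite eqxx; under eq_bigr do rewrite mulrC.
by move=> ->; rewrite mulr1.
Qed.

Lemma measurable_tensor_trace X : random_tensor X ->
  measurable_fun setT (fun t => tensor_trace (X t)).
Proof.
move=> rX; suff: complex_measurable (fun t => \sum_a X t (a, a)) by case.
by apply: complex_measurable_sum => a; exact: rX.
Qed.

Lemma gram_power_trace (Z : tensor R I) k :
  tensor_trace (tensor_exp (einstein_mul (tensor_adj Z) Z) k)
  = \sum_i gram_eigen Z i ^+ k.
Proof.
have eG := eigen_ofP (gram_hermitian Z).
by rewrite (tensor_exp_spectral k eG) tensor_trace_spectral //; case: eG.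
Qed.

Lemma cvg_powR_inv (a : R) : 0 < a ->
  a `^ ((2 * k.+1%:R)^-1) @[k --> \oo] --> (1 : R).
Proof.
move=> a0; have -> : (fun k => a `^ ((2 * k.+1%:R)^-1))
    = (fun k => expR (ln a / 2 * (harmonic k : R))).
  apply/funext => k; rewrite /powR gt_eqF // /harmonic /= invfM; congr expR; ring.
rewrite -[X in _ --> X]expR0 -[X in _ --> expR X](mulr0 (ln a / 2)).
apply: continuous_cvg; first exact: continuous_expR.
apply: cvgMl_tmp; exact: cvg_harmonic.
Qed.

(** The two bounds that squeeze the spectral norm: if [s] is the largest of the
[D] singular values, then [s ^+ (2 * k)] is at most the sum of their powers,
itself at most [D * s ^+ (2 * k)].  The factor [D.+1] of the second bound is
positive, so that its [2 * k]-th root tends to [1] even if [D = 0]. *)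
Lemma spectral_norm_le_trace (Z : tensor R I) k :
  spectral_norm Z <=
  (\sum_i gram_eigen Z i ^+ k.+1) `^ ((2 * k.+1%:R)^-1).
Proof.
apply/bigmax_leP; split => [|i _]; first exact: powR_ge0.
have mu0 := gram_eigen_ge0 Z.
rewrite /singular_value -/(gram_eigen Z i) -powR12_sqrt //.
have -> : gram_eigen Z i `^ 2^-1
    = (gram_eigen Z i ^+ k.+1) `^ ((2 * k.+1%:R)^-1).
  by rewrite -powR_mulrn // -powRrM invfM mulrCA mulfV ?mulr1 ?pnatr_eq0.
apply: ge0_ler_powR; rewrite ?nnegrE ?invr_ge0 ?mulr_ge0 ?exprn_ge0 //.
  by rewrite sumr_ge0 // => j _; rewrite exprn_ge0.
by rewrite (bigD1 i) //= lerDl sumr_ge0 // => j _; rewrite exprn_ge0.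
Qed.

Lemma trace_le_spectral_norm (Z : tensor R I) k :
  (\sum_i gram_eigen Z i ^+ k.+1) `^ ((2 * k.+1%:R)^-1) <=
  D.+1%:R `^ ((2 * k.+1%:R)^-1) * spectral_norm Z.
Proof.
have s0 := spectral_norm_ge0 Z.
have -> : spectral_norm Z
    = ((spectral_norm Z ^+ 2) ^+ k.+1) `^ ((2 * k.+1%:R)^-1).
  by rewrite -exprM -powR_mulrn // -powRrM natrM mulfV ?powRr1 //.
rewrite -powRM ?exprn_ge0 //.
apply: ge0_ler_powR; rewrite ?nnegrE ?invr_ge0 ?mulr_ge0 ?exprn_ge0 //.
  by rewrite sumr_ge0 // => j _; rewrite exprn_ge0 ?gram_eigen_ge0.
apply: (@le_trans _ _ (D%:R * (spectral_norm Z ^+ 2) ^+ k.+1)).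
  rewrite mulr_natl -[in leRHS](card_ord D) -sumr_const.
  apply: ler_sum => i _; rewrite lerXn2r ?nnegrE ?exprn_ge0 ?gram_eigen_ge0 //.
  exact: gram_eigen_le.
by rewrite ler_wpM2r ?exprn_ge0 // ler_nat.
Qed.

(** The traces of the powers of the Gram tensor are polynomials in the entries,
hence measurable, unlike the chosen eigenvectors. *)
Lemma measurable_spectral_norm X : random_tensor X ->
  measurable_fun setT (fun t => spectral_norm (X t)).
Proof.
move=> rX; pose h k t := (tensor_trace
  (tensor_exp (einstein_mul (tensor_adj (X t)) (X t)) k.+1)) `^ ((2 * k.+1%:R)^-1).
apply: (@measurable_fun_cvg _ _ _ _ h) => [k|t _].
  apply: (measurableT_comp (measurable_powR _)).
  apply/measurable_tensor_trace/random_tensor_exp/random_tensorM => //.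
  exact: random_tensor_adj.
rewrite /h; under eq_fun do rewrite gram_power_trace.
apply: (@squeeze_cvgr _ _ _ _ (fun=> spectral_norm (X t)) (fun k : nat =>
  D.+1%:R `^ ((2 * k.+1%:R)^-1) * spectral_norm (X t))).
- near=> k.
  by rewrite spectral_norm_le_trace trace_le_spectral_norm.
- exact: cvg_cst.
- rewrite -[X in _ --> X]mul1r; apply: cvgMr_tmp.
  exact: cvg_powR_inv.
Unshelve. all: by end_near.
Qed.

End Measurability.

(** * Measurability of real powers *)

Section Limits.
Context {R : realType}.

Lemma cvg_sum_seq (J : Type) (r : seq J) (F : J -> nat -> R) (l : J -> R) :
  (forall j, F j k @[k --> \oo] --> l j) ->
  \sum_(j <- r) F j k @[k --> \oo] --> \sum_(j <- r) l j.
Proof.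
move=> Fl; elim: r => [|j r IHr].
  by under eq_fun do rewrite big_nil; rewrite big_nil; exact: cvg_cst.
by under eq_fun do rewrite big_cons; rewrite big_cons; exact: cvgD.
Qed.

(** Newton's method for the equation [expR y = x], started at [0].  Its iterates
use only products and exponentials, and they converge for every [x > 0]. *)
Fixpoint newton_ln (k : nat) (x : R) : R :=
  if k is k'.+1 then newton_ln k' x - 1 + x * expR (- newton_ln k' x) else 0.

(** The error [z] obeys [z' = z - 1 + expR (- z)].  It is nonnegative after one
step by convexity, then nonincreasing, and [0] is the only fixed point. *)
Lemma newton_ln_cvg x : 0 < x -> newton_ln k x @[k --> \oo] --> ln x.
Proof.
move=> x0; pose z k := newton_ln k.+1 x - ln x.
have step y : y - 1 + x * expR (- y) - ln x
    = (y - ln x) - 1 + expR (- (y - ln x)).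
  have -> : - (y - ln x) = ln x - y by ring.
  by rewrite expRD lnK ?posrE //; ring.
have zS k : z k.+1 = z k - 1 + expR (- z k) by exact: step.
have z_ge0 k : 0 <= z k.
  rewrite /z /= step; set y := _ - ln x.
  by have := expR_ge1Dx (- y); lra.
have z_dec : nonincreasing_seq z.
  apply/nonincreasing_seqP => k; rewrite zS.
  have : expR (- z k) <= 1 by rewrite -expR0 ler_expR oppr_le0.
  lra.
have z_cvg : cvgn z.
  by apply: nonincreasing_is_cvgn => //; exists 0 => _ [k _ <-].
set l := limn z in z_cvg.
have zS_cvg : z k.+1 @[k --> \oo] --> l - 1 + expR (- l).
  under eq_fun do rewrite zS.
  apply: cvgD; first by apply: cvgB z_cvg _; exact: cvg_cst.
  apply: continuous_cvg; first exact: continuous_expR.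
  exact: cvgN.
have l0 : l = 0.
  have zS_cvg' : z k.+1 @[k --> \oo] --> l by rewrite cvg_shiftS.
  have l_fix : l = l - 1 + expR (- l).
    by apply: cvg_unique zS_cvg' zS_cvg; exact: norm_hausdorff.
  apply/eqP; rewrite -oppr_eq0; apply/eqP/expR_inj; rewrite expR0.
  have fix1 (a b : R) : a = a - 1 + b -> b = 1 by lra.
  exact: fix1 l_fix.
rewrite -(cvg_shiftS (newton_ln ^~ x)).
have -> : [sequence newton_ln k.+1 x]_k = (fun k => z k + ln x).
  by apply/funext => k; rewrite /z subrK.
have : z k + ln x @[k --> \oo] --> l + ln x.
  by apply: cvgD; [exact: z_cvg|exact: cvg_cst].
by rewrite l0 add0r.
Qed.

End Limits.

Section MeasurableCalculus.
Context {R : realType} {d : measure_display} {T : measurableType d}.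
Context {N : nat} (I : 'I_N -> nat).
Context (A : T -> tensor R I).
Context (rA : random_tensor A) (pA : forall t, positive_definite (A t)).

Definition measurable_calculus (f : R -> R) :=
  random_tensor (fun t => spectral_sum f (eigen_of (A t))).

Let oA t : orthonormal_cols (eigen_of (A t)).2.
Proof. by have [] := eigen_ofP (pA t).1. Qed.

Lemma calculus_cst k : measurable_calculus (fun=> k).
Proof.
rewrite /measurable_calculus.
have -> : (fun t => spectral_sum (fun=> k) (eigen_of (A t)))
    = (fun=> k%:C%C *: tensor_id I).
  apply/funext => t; rewrite -(spectral_sum1 (oA t)) /spectral_sum scaler_sumr.
  by apply: eq_bigr => i _; rewrite scale1r.
exact/random_tensorZ/random_tensor_cst.
Qed.

Lemma calculus_id : measurable_calculus id.
Proof.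
have E : (fun t => spectral_sum id (eigen_of (A t))) = A.
  by apply/funext => t; have [_ <-] := eigen_ofP (pA t).1.
by rewrite /measurable_calculus E.
Qed.

(** Spectral sums multiply as the functions do, so that products are obtained
from the measurability of tensor products. *)
Lemma calculusM f g : measurable_calculus f -> measurable_calculus g ->
  measurable_calculus (fun x => f x * g x).
Proof.
move=> mf mg; have := random_tensorM mf mg.
rewrite /measurable_calculus.
by under eq_fun do rewrite (spectral_sumM _ _ (oA _)).
Qed.

Lemma calculusD f g : measurable_calculus f -> measurable_calculus g ->
  measurable_calculus (fun x => f x + g x).
Proof.
move=> mf mg; have := random_tensorD mf mg.
rewrite /measurable_calculus.
have -> // : (fun t => spectral_sum f (eigen_of (A t))
                      + spectral_sum g (eigen_of (A t)))
  = (fun t => spectral_sum (fun x => f x + g x) (eigen_of (A t))).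
apply/funext => t; rewrite /spectral_sum -big_split /=.
by apply: eq_bigr => i _; rewrite rmorphD scalerDl.
Qed.

Lemma calculusX f k : measurable_calculus f ->
  measurable_calculus (fun x => f x ^+ k).
Proof.
move=> mf; elim: k => [|k IHk]; first exact: calculus_cst.
by under eq_fun do rewrite exprS; exact: calculusM.
Qed.

Lemma calculus_sum (f : nat -> R -> R) k : (forall j, measurable_calculus (f j)) ->
  measurable_calculus (fun x => \sum_(0 <= j < k) f j x).
Proof.
move=> mf; elim: k => [|k IHk].
  by under eq_fun do rewrite big_geq //; exact: calculus_cst.
by under eq_fun do rewrite big_nat_recr //=; exact: calculusD.
Qed.

(** The eigenvectors need not be measurable, but they do not vary with [k]: for
each outcome an entry of the spectral sum is a fixed finite combination of the
values at the eigenvalues, all of which are positive. *)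
Lemma calculus_cvg (F : nat -> R -> R) f :
  (forall k, measurable_calculus (F k)) ->
  (forall x, 0 < x -> F k x @[k --> \oo] --> f x) -> measurable_calculus f.
Proof.
move=> mF Ff p.
have entry g t : spectral_sum g (eigen_of (A t)) p =
    \sum_i (g ((eigen_of (A t)).1 i))%:C%C * eigen_proj ((eigen_of (A t)).2 i) p.
  by rewrite /spectral_sum sum_ffunE; apply: eq_bigr => i _; rewrite ffunE.
have Fl t i : F k ((eigen_of (A t)).1 i) @[k --> \oo]
    --> f ((eigen_of (A t)).1 i).
  exact/Ff/positive_definite_eigen.
split.
- apply: (@measurable_fun_cvg _ _ _ _ (fun k t =>
    complex.Re (spectral_sum (F k) (eigen_of (A t)) p))) => [k|t _].
    by have [] := mF k p.
  rewrite entry Re_sum; under eq_fun do rewrite entry Re_sum.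
  apply: cvg_sum_seq => i; under eq_fun do rewrite Re_scale.
  by rewrite Re_scale; exact: cvgMr_tmp.
- apply: (@measurable_fun_cvg _ _ _ _ (fun k t =>
    complex.Im (spectral_sum (F k) (eigen_of (A t)) p))) => [k|t _].
    by have [] := mF k p.
  rewrite entry Im_sum; under eq_fun do rewrite entry Im_sum.
  apply: cvg_sum_seq => i; under eq_fun do rewrite Im_scale.
  by rewrite Im_scale; exact: cvgMr_tmp.
Qed.

Lemma calculus_exp f : measurable_calculus f ->
  measurable_calculus (fun x => expR (f x)).
Proof.
move=> mf.
apply: (@calculus_cvg (fun k x => \sum_(0 <= j < k) f x ^+ j * (j`!%:R)^-1)).
  move=> k; apply: calculus_sum => j; apply: calculusM; first exact: calculusX.
  exact: calculus_cst.
move=> x _; exact: is_cvg_series_exp_coeff.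
Qed.

Lemma calculus_ln : measurable_calculus (fun x => ln x).
Proof.
apply: calculus_cvg newton_ln_cvg => k; elim: k => [|k IHk].
  exact: calculus_cst.
apply: calculusD; first by apply: calculusD => //; exact: calculus_cst.
apply: calculusM; first exact: calculus_id.
apply: calculus_exp.
have -> : (fun x : R => - newton_ln k x) = (fun x => -1 * newton_ln k x).
  by apply/funext => x; rewrite mulN1r.
by apply: calculusM => //; exact: calculus_cst.
Qed.

Lemma random_tensor_powR p : random_tensor (fun t => tensor_powR (A t) p).
Proof.
suff H : measurable_calculus (fun x => x `^ p) by [].
apply: (@calculus_cvg (fun _ x => expR (p * ln x))) => [_|x x0].
  by apply: calculus_exp; apply: calculusM calculus_ln; exact: calculus_cst.
by rewrite /powR gt_eqF //; exact: cvg_cst.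
Qed.

End MeasurableCalculus.

(** * The tail bound *)

Section MarkovDominated.
Context {R : realType} {d : measure_display} {T : measurableType d}.
Context (P : probability T R).

Lemma markov_dominated (X Y : T -> R) (K s : R) : 0 < K -> 0 < s ->
  measurable_fun setT X -> measurable_fun setT Y ->
  (forall t, 0 <= Y t) -> (forall t, X t <= K * Y t) ->
  (P [set t | (s <= X t)%R] <= (K / s)%:E * 'E_P[Y])%E.
Proof.
move=> K0 s0 mX mY Y0 XY.
pose Y' : {RV P >-> R} := HB.pack Y (isMeasurableFun.Build _ _ _ _ Y mY).
have sK0 : 0 < s / K by rewrite divr_gt0.
have EY : ('E_P[Y] = 'E_P[id \o (fun x => `|x|%R) \o Y'])%E.
  by congr expectation; apply/funext => t /=; rewrite ger0_norm.
have H := @markov _ _ _ P Y' id _ sK0 (@measurable_id _ _ _) (fun _ => id)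
  (fun _ _ _ _ => id).
rewrite -EY in H.
have -> : (K / s)%:E = ((s / K)^-1)%:E by rewrite invf_div.
rewrite lee_pdivlMl //; apply: le_trans H; rewrite lee_pmul2l //.
have mge (Z : T -> R) r : measurable_fun setT Z -> measurable [set t | r <= Z t].
  move=> mZ; have := mZ measurableT _ (measurable_itv `[r, +oo[).
  rewrite setTI; congr measurable; apply/seteqP.
  by split=> t; rewrite /= in_itv /= andbT.
apply: le_measure.
- by rewrite inE; exact: mge.
- rewrite inE; apply: (mge (fun t => `|Y t|)).
  exact: measurableT_comp.
- move=> t /= sX; rewrite lee_fin ler_pdivrMr // ger0_norm // mulrC.
  exact: le_trans (XY t).
Qed.

End MarkovDominated.

Theorem theorem5 (R : realType) (d : measure_display) (T : measurableType d)
    (P : probability T R) (N : nat) (I : 'I_N -> nat)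
    (N_gt0 : (0 < N)%N) (I_gt0 : forall k, (0 < I k)%N)
    (A B : T -> tensor R I)
    (rA : random_tensor A) (rB : random_tensor B)
    (pA : forall t, positive_definite (A t))
    (pB : forall t, positive_definite (B t))
    (w : R) (w_gt0 : 0 < w) (w_le1 : w <= 1)
    (m n : nat) (m_gt0 : (0 < m)%N) (n_gt0 : (0 < n)%N)
    (theta : R) (theta_gt0 : 0 < theta) :
  exists2 M : \bar R,
    is_minimum [set g_bound w c | c in [set c : R | 0 < c]] M &
    (P [set t | (theta <=
          spectral_norm (tensor_powR (A t) (n%:R * w)
                         - tensor_powR (B t) (m%:R * w)))%R]
     <= ((tensor_dim I)%:R ^+ 2 / (w * theta))%:E * M *
        'E_P[fun t => (spectral_norm (tensor_exp (A t) n - tensor_exp (B t) m)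
                         `^ w)%R])%E.
Proof.
have [M minM w_le_M] := g_bound_min w_gt0 w_le1; exists M => //.
set D : R := (tensor_dim I)%:R.
have D_ge1 : 1 <= D by rewrite ler1n prodn_gt0.
have D_gt0 : 0 < D by exact: lt_le_trans D_ge1.
set Y := fun t => spectral_norm (tensor_exp (A t) n - tensor_exp (B t) m) `^ w.
have mpow p q : measurable_fun setT (fun t =>
    spectral_norm (tensor_powR (A t) p - tensor_powR (B t) q)).
  apply: measurable_spectral_norm; apply: random_tensorB.
  - exact: random_tensor_powR.
  - exact: random_tensor_powR.
have mY : measurable_fun setT Y.
  apply: (measurableT_comp (measurable_powR _)).
  apply: measurable_spectral_norm; apply: random_tensorB;
    exact: random_tensor_exp.
have Y_ge0 t : 0 <= Y t by exact: powR_ge0.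
apply: le_trans (markov_dominated P D_gt0 theta_gt0 (mpow _ _) mY Y_ge0 _) _.
  by move=> t; exact: spectral_norm_powR_le (pA t) (pB t) (ltW w_gt0) w_le1.
apply: lee_wpmul2r.
  by apply: expectation_ge0 => t; exact: Y_ge0.
(* For the lower bound [w] of [M] the target constant is [D ^+ 2 / theta],
   which exceeds the Markov constant [D / theta] by a factor [D]. *)
apply: (@le_trans _ _ ((D ^+ 2 / (w * theta))%:E * w%:E)%E).
  rewrite -EFinM lee_fin.
  have -> : D ^+ 2 / (w * theta) * w = D * (D / theta).
    by field; rewrite !gt_eqF.
  by rewrite ler_peMl // divr_ge0 // ltW.
apply: lee_wpmul2l => //.
by rewrite lee_fin divr_ge0 ?exprn_ge0 ?mulr_ge0 // ltW.
Qed.
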